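(* Let $\mathcal Y$ be an antisymmetric coherent configuration and $L$ a transitive permutation group of odd order. Then $gb(\mathcal Y\uparrow L)\le\max\{gb(\mathcal Y),b\}$ where $b=gb(\mathrm{Inv}(L))$. Moreover, if $\mathcal Y$ is not complete, then $b(\mathcal Y\uparrow L)\le b(\mathcal Y)+\max\{0,\,b-\lceil(b(\mathcal Y)-1)/2\rceil\}$.
   Context: A coherent configuration on a finite set $\Omega$ is $(\Omega,S)$ with $S$ a partition of $\Omega\times\Omega$ such that $1_\Omega$ is a union of elements of $S$, $s^*=\{(\beta,\alpha):(\alpha,\beta)\in s\}\in S$, and for $r,s,t\in S$ the number $|\{\gamma:(\alpha,\gamma)\in r,(\gamma,\beta)\in s\}|$ is independent of $(\alpha,\beta)\in t$; relations are unions of elements of $S$, fibers are sets $\Gamma$ with $1_\Gamma\in S$; antisymmetric: every $s\in S$ with $s=s^*$ lies in $1_\Omega$; complete: all elements of $S$ are singletons. A fission is a configuration on the same set whose relations include those of the given one. For $\Pi\subseteq2^\Omega$ the $\Pi$-fission is the smallest fission in which each member of $\Pi$ is a union of fibers; $\Pi$ is a generalized base if the $\Pi$-fission is complete; $B\subseteq\Omega$ is a base if $\{\{\beta\}:\beta\in B\}$ is a generalized base; $gb$ and $b$ are the minimal sizes. $\mathrm{Inv}(L)=(\Delta,\text{orbits of }L\text{ on }\Delta^2)$. Exponentiation: for $\mathcal Y=(\Gamma,T)$ and $L\le\mathrm{Sym}(\Delta)$, $\Delta=\{1,\dots,m\}$, with $t_1\otimes\dots\otimes t_m=\{(\alpha,\beta)\in\Gamma^m\times\Gamma^m:(\alpha_i,\beta_i)\in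 t_i\ \forall i\}$ and $L$ acting on $\Gamma^m$ by permuting coordinates, $\mathcal Y\uparrow L=(\Gamma^m,\{\bigcup_{l\in L}t^l:t=t_1\otimes\dots\otimes t_m,\ t_i\in T\})$. *)

(* Defs.v *)
(* Coherent configurations on a finite type T are given by
   their set S of basic relations, S : {set {set T * T}}. *)
From mathcomp Require Import all_boot all_order all_fingroup.
Set Implicit Arguments. Unset Strict Implicit. Unset Printing Implicit Defensive.

Section CC.
Variable T : finType.
Implicit Types (S : {set {set T * T}}) (r s t : {set T * T}).

Definition diag (A : {set T}) : {set T * T} := [set (x, x) | x in A].
Definition rel_inv s : {set T * T} := [set (p.2, p.1) | p in s].
Definition is_union S r : Prop :=
  exists P : {set {set T * T}}, P \subset S /\ cover P = r.

Definition coherent S : Prop :=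
  [/\ partition S [set: T * T],
      is_union S (diag [set: T]),
      (forall s, s \in S -> rel_inv s \in S) &
      (forall r s t, r \in S -> s \in S -> t \in S ->
         forall a b a' b', (a, b) \in t -> (a', b') \in t ->
           #|[set c | ((a, c) \in r) && ((c, b) \in s)]|
           = #|[set c | ((a', c) \in r) && ((c, b') \in s)]|)].

Definition fiber S (X : {set T}) : Prop := diag X \in S.
Definition union_of_fibers S (X : {set T}) : Prop :=
  exists F : {set {set T}}, (forall Y, Y \in F -> fiber S Y) /\ cover F = X.

Definition cc_antisymmetric S : Prop :=
  forall s, s \in S -> rel_inv s = s -> s \subset diag [set: T].
Definition cc_complete S : Prop := forall s, s \in S -> #|s| = 1.

Definition finer S S' : Prop := forall r, is_union S r -> is_union S' r.
Definition fission S S' : Prop := coherent S' /\ finer S S'.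

Definition Pi_fission S (Pi : {set {set T}}) S' : Prop :=
  [/\ fission S S',
      (forall X, X \in Pi -> union_of_fibers S' X) &
      (forall S'', fission S S'' -> (forall X, X \in Pi -> union_of_fibers S'' X) ->
         finer S' S'')].

Definition gen_base S (Pi : {set {set T}}) : Prop :=
  exists S', Pi_fission S Pi S' /\ cc_complete S'.
Definition base S (B : {set T}) : Prop := gen_base S [set [set x] | x in B].

Definition is_gb S (n : nat) : Prop :=
  (exists Pi, gen_base S Pi /\ #|Pi| = n) /\
  (forall Pi, gen_base S Pi -> n <= #|Pi|).
Definition is_b S (n : nat) : Prop :=
  (exists B, base S B /\ #|B| = n) /\
  (forall B, base S B -> n <= #|B|).
End CC.

Section Expo.
Variables (G : finType) (m : nat).
Local Notation pt := {ffun 'I_m -> G}.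

Definition tensor (f : {ffun 'I_m -> {set G * G}}) : {set pt * pt} :=
  [set p : pt * pt | [forall i, (p.1 i, p.2 i) \in f i]].
Definition permc (l : {perm 'I_m}) (a : pt) : pt := [ffun i => a ((l^-1)%g i)].
Definition rel_act (l : {perm 'I_m}) (t : {set pt * pt}) : {set pt * pt} :=
  [set (permc l p.1, permc l p.2) | p in t].

Definition expo (S : {set {set G * G}}) (L : {set {perm 'I_m}}) : {set {set pt * pt}} :=
  [set \bigcup_(l in L) rel_act l (tensor f)
     | f in [set f : {ffun 'I_m -> {set G * G}} | [forall i, f i \in S]]].
End Expo.

Definition Inv (m : nat) (L : {set {perm 'I_m}}) : {set {set 'I_m * 'I_m}} :=
  [set [set ((l : {perm _}) p.1, l p.2) | l in L] | p in [set: 'I_m * 'I_m]].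

(* Main.v *)
Require Import Defs.
From mathcomp Require Import all_boot all_order all_fingroup.
Set Implicit Arguments. Unset Strict Implicit. Unset Printing Implicit Defensive.

(** A set [Pi] is a generalized base iff every fission in which its members are unions of
    fibers is complete, so fix such a fission [W] of the exponentiation.  The Hamming distance
    is constant on the basic relations of [W]; hence on each line of the Hamming graph the
    points nearest to a box that is a union of fibers are recognisable.  This lets chosen sets
    or points of [G^m] mark subsets of [G] and sets of coordinates on every line.  If all
    coordinates and all members of a generalized base of [S] are marked, the quotient of [W]
    by "equal [i]-th coordinate" is a coherent fission of [S], hence complete for each [i],
    and so is [W].

    For the first bound, a single "staircase", the union of the boxes Delta^k x {q}^(m-k),
    marks all coordinates together with one member Delta of the generalized base of [S]; the
    other members D are marked by the powers D^m.

    For the second bound, two points that take the base points p, q on a set A of coordinates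
    and its complement, in the two possible orders, mark p, q and A, because antisymmetry
    distinguishes (p, q) from (q, p); each of the remaining sets costs one extra point.  A
    marked constant point is a singleton fiber, and the quotient of its neighbourhood in one
    basic relation by the directions of the lines is a coherent fission of [Inv L], which is
    therefore complete: all coordinates are marked. *)

(** * Coherent configurations *)

Local Notation basic S a b := (pblock S (a, b)).

Section Partition.
Variables (T : finType) (S : {set {set T * T}}).
Hypothesis partS : partition S [set: T * T].

Lemma mem_basic p : p \in pblock S p.
Proof. by rewrite mem_pblock (cover_partition partS) inE. Qed.

Lemma basic_in p : pblock S p \in S.
Proof. by rewrite pblock_mem // (cover_partition partS) inE. Qed.

Lemma basic_eq r p : r \in S -> p \in r -> pblock S p = r.
Proof. by move=> rS pr; apply: def_pblock => //; apply: partition_trivIset partS. Qed.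

Lemma eq_basicE r p : r \in S -> (pblock S p == r) = (p \in r).
Proof. by move=> rS; apply/eqP/idP=> [<-|/basic_eq->//]; apply: mem_basic. Qed.

Lemma mem_basic_eq r p q : r \in S -> pblock S p = pblock S q -> p \in r -> q \in r.
Proof. by move=> rS pq; rewrite -!eq_basicE // pq. Qed.

Lemma is_unionP r :
  is_union S r <-> (forall p q, pblock S p = pblock S q -> p \in r -> q \in r).
Proof.
split=> [[P [PS <-]] p q pq /bigcupP[s sP ps]|r_closed].
  by apply/bigcupP; exists s => //; apply: mem_basic_eq pq ps; apply: (subsetP PS).
exists [set pblock S p | p in r]; split.
  by apply/subsetP=> _ /imsetP[p _ ->]; apply: basic_in.
apply/setP=> q; apply/bigcupP/idP=> [[_ /imsetP[p pr ->] qp]|qr].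
  by apply: (r_closed p) => //; rewrite (basic_eq (basic_in p) qp).
by exists (pblock S q); [apply: imset_f | apply: mem_basic].
Qed.

Lemma finerP (R : {set {set T * T}}) :
  finer R S <->
  (forall r p q, r \in R -> pblock S p = pblock S q -> p \in r -> q \in r).
Proof.
split=> [finRS r p q rR|R_closed r [P [PR <-]]].
  move: p q; apply/is_unionP; apply: finRS; exists [set r].
  by rewrite sub1set rR /cover big_set1.
apply/is_unionP=> p q pq /bigcupP[s sP ps].
by apply/bigcupP; exists s => //; apply: R_closed pq ps; apply: (subsetP PR).
Qed.

Lemma completeP : cc_complete S <-> injective (pblock S).
Proof.
split=> [complS p q pq|pblock_inj s sS].
  have /eqP/cards1P[x px] := complS _ (basic_in p).
  have := mem_basic p; have := mem_basic q.
  by rewrite -pq px !inE => /eqP-> /eqP->.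
have /set0Pn[p ps] : s != set0 by apply: contraTneq sS => ->; case/and3P: partS.
apply/eqP/cards1P; exists p; apply/setP=> q; rewrite inE; apply/idP/eqP=> [qs|->//].
by apply: pblock_inj; rewrite !(@basic_eq s).
Qed.

Lemma complete_card_le1 : #|T| <= 1 -> cc_complete S.
Proof.
move/fintype_le1P=> eqT; apply/completeP=> -[a b] [a' b'] _.
by rewrite (eqT a a') (eqT b b').
Qed.

End Partition.

Definition class_invariant (T : finType) (S : {set {set T * T}}) (P : rel T) :=
  forall a b a' b', basic S a b = basic S a' b' -> P a b = P a' b'.

Section Coherent.
Variables (T : finType) (S : {set {set T * T}}).
Hypothesis cohS : coherent S.

Lemma coherent_partition : partition S [set: T * T]. Proof. by case: cohS. Qed.
Let partS := coherent_partition.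

Lemma basic_diag a b c : basic S a a = basic S b c -> b = c.
Proof.
case: cohS => _ diagS _ _ /((is_unionP partS _).1 diagS).
by case/(_ _)/imsetP=> [|x _ [-> ->]//]; apply: imset_f; rewrite inE.
Qed.

Lemma basic_eq_pt a b a' b' : basic S a b = basic S a' b' -> (a == b) = (a' == b').
Proof.
move=> ab; apply/eqP/eqP=> eq_pts; move: ab; rewrite eq_pts; first by move/basic_diag.
by move/esym/basic_diag.
Qed.

Lemma basic_inv a b a' b' : basic S a b = basic S a' b' -> basic S b a = basic S b' a'.
Proof.
case: cohS => _ _ invS _ ab.
have inv_ab x y : basic S a b = basic S x y -> basic S y x = rel_inv (basic S a b).
  move=> xy; apply: (basic_eq partS); first exact: invS (basic_in partS _).
  by apply/imsetP; exists (x, y); rewrite ?xy ?mem_basic.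
by rewrite (inv_ab _ _ ab) (inv_ab a b).
Qed.

Lemma card_basic_path r s a b a' b' : basic S a b = basic S a' b' ->
  #|[set c | (basic S a c == r) && (basic S c b == s)]|
  = #|[set c | (basic S a' c == r) && (basic S c b' == s)]|.
Proof.
move=> ab; have [/andP[rS sS]|rsS] := boolP ((r \in S) && (s \in S)).
  case: cohS => _ _ _ /(_ r s _ rS sS (basic_in partS (a, b)) a b a' b').
  rewrite mem_basic // ab mem_basic // => /(_ isT isT).
  by congr (_ = _); apply: eq_card => c; rewrite !inE !eq_basicE.
rewrite !eq_card0 // => c; rewrite !inE; apply: contraNF rsS.
  by case/andP=> /eqP<- /eqP<-; rewrite !basic_in.
by case/andP=> /eqP<- /eqP<-; rewrite !basic_in.
Qed.

Lemma card_path_class (P Q : rel T) a b a' b' :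
  class_invariant S P -> class_invariant S Q -> basic S a b = basic S a' b' ->
  #|[set c | P a c && Q c b]| = #|[set c | P a' c && Q c b']|.
Proof.
move=> invP invQ ab.
pose holds (R : rel T) r := [exists p, (pblock S p == r) && R p.1 p.2].
have holdsE R x y : class_invariant S R -> holds R (basic S x y) = R x y.
  move=> invR; apply/existsP/idP=> [[[x' y'] /andP[/eqP xy]]|xyR].
    by rewrite /= (invR _ _ _ _ xy).
  by exists (x, y); rewrite eqxx.
pose K := [set rs : {set T * T} * {set T * T} | holds P rs.1 && holds Q rs.2].
have sum_path x y : #|[set c | P x c && Q c y]|
    = \sum_(rs in K) #|[set c | (basic S x c == rs.1) && (basic S c y == rs.2)]|.
  rewrite -sum1dep_card (partition_big (fun c => (basic S x c, basic S c y)) (mem K)) /=.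
    apply: eq_bigr => -[r s] /=; rewrite inE /= => /andP[rP sQ].
    rewrite -sum1dep_card; apply: eq_bigl => c; rewrite xpair_eqE /=.
    rewrite -(holdsE P x c) // -(holdsE Q c y) // andbC.
    by case: eqP => //= ->; case: eqP => //= ->; rewrite rP.
  by move=> c; rewrite inE /= !holdsE.
by rewrite !sum_path; apply: eq_bigr => rs _; apply: card_basic_path.
Qed.

Lemma basic_transport a b a' b' c : basic S a b = basic S a' b' ->
  exists c', basic S a c = basic S a' c' /\ basic S c b = basic S c' b'.
Proof.
move/(card_basic_path (basic S a c) (basic S c b))=> eq_card.
have : 0 < #|[set d | (basic S a d == basic S a c) && (basic S d b == basic S c b)]|.
  by apply/card_gt0P; exists c; rewrite inE !eqxx.
by rewrite eq_card => /card_gt0P[c']; rewrite inE => /andP[/eqP<- /eqP<-]; exists c'.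
Qed.

Lemma basic_fst a b a' b' : basic S a b = basic S a' b' -> basic S a a = basic S a' a'.
Proof. by case/(basic_transport a)=> c' [aa _]; have := basic_diag aa; rewrite aa => <-. Qed.

Lemma basic_snd a b a' b' : basic S a b = basic S a' b' -> basic S b b = basic S b' b'.
Proof. by move/basic_inv/basic_fst. Qed.

Lemma union_of_fibersP X : union_of_fibers S X <->
  (forall x y, basic S x x = basic S y y -> x \in X -> y \in X).
Proof.
split=> [[F [fiberF <-]] x y xy /bigcupP[Y YF xY]|X_closed].
  apply/bigcupP; exists Y => //.
  have: (y, y) \in diag Y.
    by apply: (mem_basic_eq partS (fiberF _ YF) xy); apply: imset_f.
  by case/imsetP=> z zY [->].
pose fiber_of x := [set y | (y, y) \in basic S x x].
have diag_fiber x : diag (fiber_of x) = basic S x x.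
  apply/setP=> -[y z]; apply/imsetP/idP=> [[t] | yz].
    by rewrite inE => tt [-> ->].
  have xyz := esym (basic_eq partS (basic_in partS (x, x)) yz).
  by rewrite -(basic_diag xyz) in yz *; exists y; rewrite ?inE.
exists [set fiber_of x | x in X]; split.
  by move=> _ /imsetP[x xX ->]; rewrite /fiber diag_fiber basic_in.
apply/setP=> y; apply/bigcupP/idP=> [[_ /imsetP[x xX ->]]|yX].
  by rewrite inE -(eq_basicE partS) ?basic_in // => /eqP/esym/X_closed; apply.
by exists (fiber_of y); [apply: imset_f | rewrite inE mem_basic].
Qed.

Lemma mem_union_of_fibers X x y :
  union_of_fibers S X -> basic S x x = basic S y y -> (x \in X) = (y \in X).
Proof. by move/union_of_fibersP=> X_closed xy; apply/idP/idP; apply: X_closed. Qed.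

Lemma basic_singleton_fiber x y z : union_of_fibers S [set x] ->
  basic S y y = basic S z z -> basic S x y = basic S x z.
Proof.
move=> fib_x yz; have [x' [yx _]] := basic_transport x yz.
have := mem_union_of_fibers fib_x (basic_snd yx); rewrite !inE eqxx => /esym/eqP x'x.
by rewrite x'x in yx; apply: basic_inv.
Qed.

End Coherent.

Section Colouring.
Variables (T C : finType) (col : T * T -> C).
Let S := preim_partition col setT.

Lemma preim_basicP p q : pblock S p = pblock S q <-> col p = col q.
Proof.
have partS : partition S setT := preim_partitionP col setT.
have eq_col : {in setT & &, equivalence_rel [rel x y | col x == col y]}.
  by move=> x y z _ _ _; split=> /= [|/eqP->].
split=> [pq|pq].
  have := mem_basic partS q; rewrite -pq pblock_equivalence_partition ?inE //.
  by move/eqP.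
apply/eqP; rewrite eq_pblock ?(partition_trivIset partS) ?(cover_partition partS) ?inE //.
by rewrite pblock_equivalence_partition ?inE //= pq.
Qed.

Lemma coherent_colouring :
  (forall a b c, col (a, a) = col (b, c) -> b = c) ->
  (forall a b a' b', col (a, b) = col (a', b') -> col (b, a) = col (b', a')) ->
  (forall u v a b a' b', col (a, b) = col (a', b') ->
     #|[set c | (col (a, c) == u) && (col (c, b) == v)]|
     = #|[set c | (col (a', c) == u) && (col (c, b') == v)]|) ->
  coherent S.
Proof.
move=> col_diag col_inv col_path; have partS : partition S setT := preim_partitionP col setT.
have colP r : r \in S -> exists p, r = [set q | col q == col p].
  by case/imsetP=> p _ ->; exists p; apply/setP=> q; rewrite !inE eq_sym.
split=> //.
- apply/(is_unionP partS) => -[a b] [c d] /preim_basicP col_ab /imsetP[x _ [ax bx]].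
  move: col_ab; rewrite ax bx => /col_diag->; apply: imset_f; exact: in_setT.
- move=> s /colP[[a b] ->]; apply/imsetP; exists (b, a) => //.
  apply/setP=> -[c d]; rewrite !inE; apply/imsetP/eqP=> [[[x y]]|col_cd].
    by rewrite inE /= => /eqP/col_inv col_xy [-> ->].
  by exists (d, c) => //; rewrite inE; apply/eqP/col_inv.
- move=> r s t /colP[p ->] /colP[q ->] /colP[w ->] a b a' b'; rewrite !inE => /eqP ab /eqP ab'.
  have := col_path (col p) (col q) a b a' b'; rewrite ab ab' => /(_ erefl).
  by congr (_ = _); apply: eq_card => c; rewrite !inE.
Qed.

End Colouring.

Lemma coherent_discrete (T : finType) : coherent (preim_partition id [set: T * T]).
Proof.
apply: coherent_colouring => [a b c [-> ->] //|a b a' b' [-> ->] //|].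
by move=> u v a b a' b' [-> ->].
Qed.

Section GeneralizedBase.
Variables (T : finType) (S : {set {set T * T}}).

Lemma gen_baseP (Pi : {set {set T}}) : gen_base S Pi <->
  (forall S', fission S S' -> (forall X, X \in Pi -> union_of_fibers S' X) -> cc_complete S').
Proof.
split=> [[R [[[cohR _] _ minR] complR]] S' fisS' uniS'|compl_fission].
  have [partR partS'] := (coherent_partition cohR, coherent_partition fisS'.1).
  have /(finerP partS') finRS' := minR S' fisS' uniS'.
  apply/(completeP partS') => p q pq.
  have := finRS' _ _ _ (basic_in partR p) pq (mem_basic partR p).
  by rewrite -(eq_basicE partR) ?basic_in // => /eqP/((completeP partR).1 complR).
have cohD := coherent_discrete T; have partD := coherent_partition cohD.
have basicD p q : pblock (preim_partition id setT) p = pblock (preim_partition id setT) q ->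
  p = q :> T * T by move/preim_basicP.
exists (preim_partition id setT); split; last by apply/(completeP partD)/basicD.
split=> [|X XPi|S' fisS' uniS'].
- by split=> //; apply/(finerP partD) => r p q _ /basicD->.
- by apply/union_of_fibersP => // x y /basicD[->].
have partS' := coherent_partition fisS'.1.
apply/(finerP partS') => r p q _.
by move/((completeP partS').1 (compl_fission _ fisS' uniS'))->.
Qed.

Lemma gen_base_set0 : coherent S -> gen_base S set0 -> cc_complete S.
Proof.
by move=> cohS /gen_baseP complS; apply: complS => [|X]; [split=> // r | rewrite inE].
Qed.

End GeneralizedBase.

Section Antisymmetric.
Variables (T : finType) (S : {set {set T * T}}).
Hypotheses (cohS : coherent S) (antiS : cc_antisymmetric S).

Lemma antisym_basic a b : a != b -> basic S a b <> basic S b a.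
Proof.
have partS := coherent_partition cohS; move=> /eqP ab eq_ab.
have inv_in : rel_inv (basic S a b) \in S by case: cohS => _ _ + _; apply; apply: basic_in.
have inv_ba : (b, a) \in rel_inv (basic S a b).
  by apply/imsetP; exists (a, b) => //; apply: mem_basic.
have inv_ab : rel_inv (basic S a b) = basic S a b.
  by rewrite -(basic_eq partS inv_in inv_ba).
have /subsetP/(_ _ (mem_basic partS (a, b))) := antiS (basic_in partS _) inv_ab.
by case/imsetP=> x _ [ax bx]; case: ab; rewrite ax bx.
Qed.

Lemma antisym_singleton_fiber a : #|T| <= 2 -> union_of_fibers S [set a].
Proof.
move=> T_le2; apply/(union_of_fibersP cohS) => b x bx /set1P bE; rewrite {b}bE in bx.
rewrite inE; apply: contraLR T_le2 => xa; rewrite -ltnNge.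
have [c [axc _]] := basic_transport cohS x bx.
have xc : x != c by rewrite -(basic_eq_pt cohS axc) eq_sym.
apply/card_gt2P; exists a, x, c; split=> //; rewrite eq_sym xa xc; split=> //.
by apply/eqP=> ca; case: (antisym_basic xa); rewrite axc ca.
Qed.

End Antisymmetric.

Section Orbitals.
Variables (m : nat) (L : {group {perm 'I_m}}).

Definition pair_orbit (p : 'I_m * 'I_m) := [set ((l : {perm 'I_m}) p.1, l p.2) | l in L].

Lemma pair_orbitP a b a' b' : pair_orbit (a, b) = pair_orbit (a', b') <->
  exists2 l : {perm 'I_m}, l \in L & a' = l a /\ b' = l b.
Proof.
split=> [orbit_eq|[l lL [-> ->]]].
  have /imsetP[l lL [-> ->]] : (a', b') \in pair_orbit (a, b); last by exists l.
  by rewrite orbit_eq; apply/imsetP; exists 1%g; rewrite //= !perm1.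
apply/setP=> p; apply/imsetP/imsetP=> -[k kL ->].
  by exists (l^-1 * k)%g; rewrite ?groupM ?groupV //= !permM !permK.
by exists (l * k)%g; rewrite ?groupM //= !permM.
Qed.

Lemma Inv_preim_partition : Inv L = preim_partition pair_orbit setT.
Proof.
apply: eq_imset => -[a b]; apply/setP=> -[a' b']; rewrite !inE.
apply/imsetP/eqP=> [[l lL [-> ->]]|/pair_orbitP[l lL [-> ->]]]; last by exists l.
by apply/pair_orbitP; exists l.
Qed.

Lemma coherent_Inv : coherent (Inv L).
Proof.
rewrite Inv_preim_partition; apply: coherent_colouring => [a b c|a b a' b'|u v a b a' b'].
- by case/pair_orbitP=> l _ [-> ->].
- by case/pair_orbitP=> l lL [-> ->]; apply/pair_orbitP; exists l.
case/pair_orbitP=> l lL [-> ->]; rewrite -(card_imset _ (@perm_inj _ l)); apply: eq_card => c.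
have orbit_l i j : pair_orbit (l i, l j) = pair_orbit (i, j).
  by apply/esym/pair_orbitP; exists l.
by rewrite -(permKV l c) mem_imset ?inE ?orbit_l //; apply: perm_inj.
Qed.

Lemma gen_base_Inv_gt0 (Pi : {set {set 'I_m}}) :
  [transitive L, on [set: 'I_m] | 'P] -> 1 < m -> gen_base (Inv L) Pi -> 0 < #|Pi|.
Proof.
move=> transL m_gt1 base_Pi; rewrite card_gt0; apply: contraTneq m_gt1 => Pi0.
rewrite {Pi}Pi0 in base_Pi; have partI := coherent_partition coherent_Inv.
have /(completeP partI) := gen_base_set0 coherent_Inv base_Pi.
rewrite Inv_preim_partition => basic_inj; rewrite -leqNgt -[m]card_ord.
apply/fintype_le1P=> i j; have [l lL ij] := atransP2 transL (in_setT i) (in_setT j).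
suff /basic_inj[] : pblock (preim_partition pair_orbit setT) (i, i)
  = pblock (preim_partition pair_orbit setT) (j, j) by [].
by apply/preim_basicP/pair_orbitP; exists l.
Qed.

End Orbitals.

(** * Quotients *)

Section Quotient.
Variables (T U : finType) (S : {set {set T * T}}) (D : {set T}) (f : T -> U).
Hypothesis cohS : coherent S.
Hypothesis ker_inv : class_invariant S (fun a b => [&& a \in D, b \in D & f a == f b]).
Hypothesis f_onto : forall u, exists2 a, a \in D & f a = u.

Lemma mem_domain_class a b a' b' : basic S a b = basic S a' b' ->
  (a \in D) = (a' \in D) /\ (b \in D) = (b' \in D).
Proof.
move=> ab; have := ker_inv (basic_fst cohS ab); have := ker_inv (basic_snd cohS ab).
by rewrite !eqxx !andbT !andbb.
Qed.

Definition quotient_colour (x : U * U) : {set {set T * T}} :=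
  [set pblock S p | p in setX D D & (f p.1, f p.2) == x].

Definition quotient_config := preim_partition quotient_colour setT.

Lemma quotient_colourP s x y :
  reflect (exists a b, [/\ a \in D, b \in D, f a = x, f b = y & s = basic S a b])
          (s \in quotient_colour (x, y)).
Proof.
apply: (iffP imsetP) => [[[a b]]|[a [b [Da Db <- <- ->]]]]; last first.
  by exists (a, b); rewrite // !inE Da Db eqxx.
by rewrite !inE => /andP[/andP[Da Db] /eqP[<- <-]] ->; exists a, b.
Qed.

Lemma quotient_colour_class a b a' b' : a \in D -> b \in D ->
  basic S a b = basic S a' b' -> quotient_colour (f a, f b) = quotient_colour (f a', f b').
Proof.
have sub x y x' y' : x \in D -> y \in D -> basic S x y = basic S x' y' ->
    quotient_colour (f x, f y) \subset quotient_colour (f x', f y').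
  move=> Dx Dy xy; have [Dx' Dy'] := mem_domain_class xy.
  apply/subsetP=> s /quotient_colourP[c [d [Dc Dd fc fd ->]]].
  have [c' [xc cy]] := basic_transport cohS c xy.
  have [d' [cd dy]] := basic_transport cohS d cy.
  have [_ Dc'] := mem_domain_class xc; have [Dd' _] := mem_domain_class dy.
  have := ker_inv xc; have := ker_inv dy.
  rewrite -Dx' -Dy' -Dc' -Dd' Dx Dy Dc Dd fc fd !eqxx => /esym/eqP fd' /esym/eqP fc'.
  by apply/quotient_colourP; exists c', d'; rewrite -Dc' -Dd'.
move=> Da Db ab; have [Da' Db'] := mem_domain_class ab.
by apply/eqP; rewrite eqEsubset !sub // -?Da' -?Db'.
Qed.

Lemma quotient_colour_lift a b x y : a \in D -> b \in D ->
  quotient_colour (f a, f b) = quotient_colour (x, y) ->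
  exists a' b', [/\ a' \in D, b' \in D, f a' = x, f b' = y & basic S a b = basic S a' b'].
Proof.
by move=> Da Db ab; apply/quotient_colourP; rewrite -ab; apply/quotient_colourP; exists a, b.
Qed.

Lemma card_block_class a a' : a \in D -> basic S a a = basic S a' a' ->
  #|[set c in D | f c == f a]| = #|[set c in D | f c == f a']|.
Proof.
move=> Da aa; have [Da' _] := mem_domain_class aa.
have := card_path_class cohS (Q := fun _ _ => true) ker_inv (fun _ _ _ _ _ => erefl) aa.
rewrite -Da' Da /=; congr (_ = _); apply: eq_card => c.
  by rewrite !inE andbT eq_sym.
by rewrite !inE andbT eq_sym.
Qed.

Lemma card_block_colour u : exists2 k, 0 < k &
  forall x z, quotient_colour (x, z) = u -> #|[set c in D | f c == z]| = k.
Proof.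
have [/existsP[[x z] /eqP xz]|no_u] := boolP [exists p, quotient_colour p == u]; last first.
  by exists 1 => // x z xz; case/existsP: no_u; exists (x, z); rewrite xz.
exists #|[set c in D | f c == z]|.
  by have [c Dc <-] := f_onto z; apply/card_gt0P; exists c; rewrite inE Dc eqxx.
move=> x' z'; have [[a Da <-] [c Dc <-]] := (f_onto x', f_onto z'); rewrite -xz.
case/(quotient_colour_lift Da Dc)=> _ [c' [_ _ _ <-]] /(basic_snd cohS).
exact: card_block_class.
Qed.

Definition lifted_colour u : rel T :=
  fun a b => [&& a \in D, b \in D & quotient_colour (f a, f b) == u].

Lemma lifted_colour_inv u : class_invariant S (lifted_colour u).
Proof.
move=> a b a' b' ab; have [Da Db] := mem_domain_class ab; rewrite /lifted_colour -Da -Db.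
case Da0: (a \in D) => //=; case Db0: (b \in D) => //=.
by rewrite (quotient_colour_class Da0 Db0 ab).
Qed.

Lemma card_lifted_path u v k a b : a \in D -> b \in D ->
  (forall x z, quotient_colour (x, z) = u -> #|[set c in D | f c == z]| = k) ->
  #|[set c | lifted_colour u a c && lifted_colour v c b]|
  = #|[set z | (quotient_colour (f a, z) == u) && (quotient_colour (z, f b) == v)]| * k.
Proof.
move=> Da Db card_block; rewrite -sum1_card -sum_nat_const; set Z := (X in \sum_(z in X) k).
rewrite (partition_big f (mem Z)) => [|c] /=; last first.
  by rewrite !inE => /andP[/and3P[_ _ ->] /and3P[_ _ ->]].
apply: eq_bigr => z; rewrite inE => /andP[az zb].
rewrite -(card_block _ _ (eqP az)) -sum1_card; apply: eq_bigl => c.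
rewrite !inE /lifted_colour Da Db /=; case: (c \in D) => //=.
by have [->|_] := eqVneq (f c) z; rewrite ?az ?zb ?andbF.
Qed.

Lemma coherent_quotient_config : coherent quotient_config.
Proof.
apply: coherent_colouring.
- move=> x y z; have [a Da <-] := f_onto x.
  by case/(quotient_colour_lift Da Da)=> b [c [_ _ <- <-]] /(basic_diag cohS)->.
- move=> x y x' y'; have [a Da <-] := f_onto x; have [b Db <-] := f_onto y.
  case/(quotient_colour_lift Da Db)=> a' [b' [Da' Db' <- <-]] /(basic_inv cohS).
  exact: quotient_colour_class.
move=> u v x y x' y'; have [a Da <-] := f_onto x; have [b Db <-] := f_onto y.
case/(quotient_colour_lift Da Db)=> a' [b' [Da' Db' <- <-]] ab.
have [k k_gt0 card_block] := card_block_colour u.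
apply/eqP; rewrite -(eqn_pmul2r k_gt0) -!(card_lifted_path v _ _ card_block) //.
exact/eqP/(card_path_class cohS (lifted_colour_inv u) (lifted_colour_inv v)).
Qed.

Lemma quotient_config_lift x y x' y' :
  basic quotient_config x y = basic quotient_config x' y' ->
  exists a b a' b', [/\ [/\ a \in D, b \in D, a' \in D & b' \in D],
    f a = x /\ f b = y, f a' = x' /\ f b' = y' & basic S a b = basic S a' b'].
Proof.
have [[a Da <-] [b Db <-]] := (f_onto x, f_onto y).
case/preim_basicP/(quotient_colour_lift Da Db)=> a' [b' [Da' Db' fa' fb' ab]].
by exists a, b, a', b'.
Qed.

Lemma gen_base_quotient (R : {set {set U * U}}) (Pi : {set {set U}}) : gen_base R Pi ->
  (forall r a b a' b', a \in D -> b \in D -> a' \in D -> b' \in D ->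
     basic S a b = basic S a' b' -> r \in R -> (f a, f b) \in r -> (f a', f b') \in r) ->
  (forall X a a', a \in D -> a' \in D ->
     basic S a a = basic S a' a' -> X \in Pi -> f a \in X -> f a' \in X) ->
  forall a a', a \in D -> basic S a a = basic S a' a' -> f a = f a'.
Proof.
move=> /gen_baseP complR R_closed Pi_closed a a' Da aa.
have cohQ := coherent_quotient_config; have partQ := coherent_partition cohQ.
have fisQ : fission R quotient_config.
  split=> //; apply/(finerP partQ) => r [x y] [x' y'] rR.
  case/quotient_config_lift=> c [d [c' [d' [[Dc Dd Dc' Dd'] [<- <-] [<- <-] cd]]]].
  exact: R_closed cd rR.
have uniQ X : X \in Pi -> union_of_fibers quotient_config X.
  move=> XPi; apply/(union_of_fibersP cohQ) => x y.
  case/quotient_config_lift=> c [d [c' [d' [[Dc _ Dc' _] [<- _] [<- _] cd]]]].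
  exact: Pi_closed (basic_fst cohS cd) XPi.
have /(completeP partQ) basicQ_inj := complR _ fisQ uniQ.
have /basicQ_inj[] // : basic quotient_config (f a) (f a) = basic quotient_config (f a') (f a').
exact/preim_basicP/quotient_colour_class.
Qed.

End Quotient.

(** * The Hamming graph *)

Lemma exists_neq_in (T : finType) (A : {pred T}) x : 1 < #|A| -> exists2 y, y \in A & y != x.
Proof.
case/card_gt1P=> y [z [yA zA yz]]; have [yx|] := eqVneq y x; last by exists y.
by exists z; rewrite // -yx eq_sym.
Qed.

Section Hamming.
Variables (I G : finType).
Implicit Types (a b c : {ffun I -> G}) (i j : I) (g : G) (X : I -> {set G}).

Definition diff a b : {set I} := [set i | a i != b i].
Definition hamming a b := #|diff a b|.
Definition edge i a b := diff a b == [set i].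
Definition update a i g : {ffun I -> G} := [ffun j => if j == i then g else a j].
Definition box X : {set {ffun I -> G}} := [set a in family X].

Lemma boxP X a : reflect (forall i, a i \in X i) (a \in box X).
Proof. by rewrite inE; apply: familyP. Qed.

Lemma box_set1 a : box (fun i => [set a i]) = [set a].
Proof.
apply/setP=> b; apply/boxP/set1P=> [ba|-> i]; last by rewrite inE.
by apply/ffunP=> i; apply/set1P.
Qed.

Lemma diff_sym a b : diff a b = diff b a.
Proof. by apply/setP=> i; rewrite !inE eq_sym. Qed.

Lemma edge_sym i a b : edge i a b = edge i b a.
Proof. by rewrite /edge diff_sym. Qed.

Lemma edgeP i a b : reflect (a i != b i /\ forall j, j != i -> a j = b j) (edge i a b).
Proof.
apply: (iffP eqP) => [/setP diff_ab|[ab_i ab_j]].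
  split=> [|j ji]; first by have := diff_ab i; rewrite !inE eqxx => ->.
  by have := diff_ab j; rewrite !inE (negPf ji) => /negbFE/eqP.
by apply/setP=> j; rewrite !inE; have [->|/ab_j->] := eqVneq j i; rewrite ?eqxx.
Qed.

Lemma edge_update a i g : g != a i -> edge i a (update a i g).
Proof.
by move=> ga; apply/edgeP; split=> [|j /negPf ji]; rewrite ffunE ?eqxx ?ji // eq_sym.
Qed.

Lemma exists_edge a i : 1 < #|G| -> exists b, edge i a b.
Proof. by case/(exists_neq_in (a i))=> g _ /edge_update; exists (update a i g). Qed.

Lemma edge_hamming i a b : edge i a b -> hamming a b = 1.
Proof. by rewrite /hamming => /eqP->; apply: cards1. Qed.

Lemma hamming1_edge a b : hamming a b = 1 -> exists i, edge i a b.
Proof. by move/eqP/cards1P=> [i /eqP]; exists i. Qed.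

Lemma edge_triangle i a b c :
  edge i a b -> hamming a c = 1 -> hamming c b <= 1 -> edge i a c.
Proof.
move=> /edgeP[ab_i ab_j] /hamming1_edge[j ac]; have [->//|ij] := eqVneq i j.
have /edgeP[ac_j ac_k] := ac; rewrite leqNgt => /negP[]; apply/card_gt1P; exists i, j.
by split; rewrite // inE; [rewrite -ac_k | rewrite -ab_j 1?eq_sym].
Qed.

Lemma edge_hamming_lt i a b c : edge i a c -> (hamming c b < hamming a b) = (c i == b i).
Proof.
move=> /edgeP[ac_i ac_j]; have [cb|cb] := eqVneq (c i) (b i).
  apply: proper_card; apply/properP; split; last by exists i; rewrite !inE -?cb ?eqxx.
  apply/subsetP=> j; rewrite !inE.
  by have [->|/ac_j->] := eqVneq j i; rewrite ?cb ?eqxx.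
apply/negbTE; rewrite -leqNgt; apply: subset_leq_card; apply/subsetP=> j; rewrite !inE.
by have [->|/ac_j->] := eqVneq j i.
Qed.

Lemma edges_hamming_le1 i j a b c :
  edge i a b -> edge j a c -> (hamming b c <= 1) = (i == j).
Proof.
move=> /edgeP[ab_i ab_k] /edgeP[+ +]; have [<-{j}|ij] := eqVneq i j => ac_j ac_k.
  rewrite -(cards1 i); apply: subset_leq_card; apply/subsetP=> k; rewrite !inE.
  by apply: contraR => ki; rewrite -ab_k // ac_k.
apply/negbTE; rewrite -ltnNge; apply/card_gt1P; exists i, j.
by split; rewrite // inE; [rewrite -ac_k // eq_sym | rewrite -ab_k // eq_sym].
Qed.

End Hamming.

(** * Fissions of an exponentiation *)

Section ExpoFission.
Variables (G : finType) (m : nat) (S : {set {set G * G}}) (L : {group {perm 'I_m}}).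
Local Notation pt := {ffun 'I_m -> G}.
Variable W : {set {set pt * pt}}.
Hypotheses (cohS : coherent S) (fisW : fission (expo S L) W).
Implicit Types (a b c d x y z : pt) (i j : 'I_m) (g h p q : G) (A : {set 'I_m}).

Let cohW : coherent W := fisW.1.
Let partS := coherent_partition cohS.
Let partW := coherent_partition cohW.

Lemma expo_class a b a' b' : basic W a b = basic W a' b' ->
  exists2 l, l \in L & forall i, basic S (a i) (b i) = basic S (a' (l i)) (b' (l i)).
Proof.
move=> ab; pose f := [ffun i => basic S (a i) (b i)].
have f_in : \bigcup_(l in L) rel_act l (tensor f) \in expo S L.
  by apply: imset_f; rewrite inE; apply/forallP=> i; rewrite ffunE basic_in.
have ab_in : (a, b) \in \bigcup_(l in L) rel_act l (tensor f).
  apply/bigcupP; exists 1%g => //; apply/imsetP; exists (a, b) => /=.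
    by rewrite inE; apply/forallP=> i; rewrite ffunE mem_basic.
  by congr (_, _); apply/ffunP=> i; rewrite ffunE invg1 perm1.
have /bigcupP[l lL /imsetP[[x y]]] := (finerP partW _).1 fisW.2 _ _ _ f_in ab ab_in.
rewrite inE => /forallP xy [-> ->]; exists l => // i; have := xy i.
by rewrite !ffunE /= permK -(eq_basicE partS) ?basic_in // => /eqP.
Qed.

Lemma diff_class (l : {perm 'I_m}) a b a' b' :
  (forall i, basic S (a i) (b i) = basic S (a' (l i)) (b' (l i))) ->
  diff a' b' = l @: diff a b.
Proof.
move=> ab; apply/setP=> i; rewrite -(permKV l i) mem_imset ?inE; last exact: perm_inj.
by rewrite (basic_eq_pt cohS (ab _)).
Qed.

Lemma hamming_class a b a' b' : basic W a b = basic W a' b' -> hamming a b = hamming a' b'.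
Proof.
case/expo_class=> l _ /diff_class diff_ab.
by rewrite /hamming diff_ab card_imset //; apply: perm_inj.
Qed.

Definition edge_equiv i a b i' a' b' :=
  [/\ edge i a b, edge i' a' b' & basic W a b = basic W a' b'].

Lemma edge_equiv_sym i a b i' a' b' : edge_equiv i a b i' a' b' -> edge_equiv i' a' b' i a b.
Proof. by case=> ab ab' /esym; split. Qed.

Lemma edge_equiv_rev i a b i' a' b' : edge_equiv i a b i' a' b' -> edge_equiv i b a i' b' a'.
Proof. by case=> ab ab' /(basic_inv cohW); split; rewrite // edge_sym. Qed.

Lemma edge_equiv_class i a b i' a' b' : edge_equiv i a b i' a' b' ->
  basic S (a i) (b i) = basic S (a' i') (b' i').
Proof.
case=> /eqP diff_ab /eqP diff_ab' /expo_class[l _ ab]; rewrite ab.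
by have := diff_class ab; rewrite diff_ab diff_ab' imset_set1 => /set1_inj->.
Qed.

Lemma basic_edge i a b a' b' : edge i a b -> basic W a b = basic W a' b' ->
  exists i', edge_equiv i a b i' a' b'.
Proof.
move=> ab ab'; have := edge_hamming ab; rewrite (hamming_class ab') => /hamming1_edge[i'].
by exists i'.
Qed.

Lemma fiber_edge i a b a' : edge i a b -> basic W a a = basic W a' a' ->
  exists i' b', edge_equiv i a b i' a' b'.
Proof.
move=> ab /(basic_transport cohW b)[b' [/(basic_edge ab)[i' ab'] _]].
by exists i', b'.
Qed.

Lemma edge_retarget g i a b i' a' b' : edge_equiv i a b i' a' b' -> g != a i ->
  exists c c', edge_equiv i a c i' a' c' /\ c i = g.
Proof.
case=> ab ab' abW ga; have [c ac ci] : exists2 c, edge i a c & c i = g.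
  by exists (update a i g); rewrite ?edge_update // ffunE eqxx.
have [c' [acW cbW]] := basic_transport cohW c abW; exists c, c'; split=> //; split=> //.
apply: (edge_triangle ab'); first by rewrite -(hamming_class acW) (edge_hamming ac).
by rewrite -(hamming_class cbW) (edges_hamming_le1 ac ab).
Qed.

Lemma edge_rebase g i a b i' a' b' : edge_equiv i a b i' a' b' ->
  exists c d c' d', edge_equiv i c d i' c' d' /\ c i = g.
Proof.
move=> ab; have [ai|ga] := eqVneq (a i) g; first by exists a, b, a', b'.
rewrite eq_sym in ga; have [c [c' [ac ci]]] := edge_retarget ab ga.
by exists c, a, c', a'; split=> //; apply: edge_equiv_rev.
Qed.

Definition edge_invariant (P : 'I_m -> pred G) := forall i a b i' a' b',
  edge_equiv i a b i' a' b' -> P i (a i) = P i' (a' i').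

Lemma edge_invariantW (P : 'I_m -> pred G) :
  (forall i a b i' a' b', edge_equiv i a b i' a' b' -> P i (a i) -> P i' (a' i')) ->
  edge_invariant P.
Proof.
move=> P_closed i a b i' a' b' ab; apply/idP/idP; first exact: P_closed ab.
exact: P_closed (edge_equiv_sym ab).
Qed.

Lemma eq_edge_invariant P Q : (forall i g, P i g = Q i g) ->
  edge_invariant P -> edge_invariant Q.
Proof. by move=> PQ invP i a b i' a' b' ab; rewrite -!PQ; apply: invP ab. Qed.

Lemma edge_invariantN P : edge_invariant P -> edge_invariant (fun i g => ~~ P i g).
Proof. by move=> invP i a b i' a' b' ab; rewrite (invP _ _ _ _ _ _ ab). Qed.

Lemma edge_invariantI P Q : edge_invariant P -> edge_invariant Q ->
  edge_invariant (fun i g => P i g && Q i g).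
Proof.
by move=> invP invQ i a b i' a' b' ab; rewrite (invP _ _ _ _ _ _ ab) (invQ _ _ _ _ _ _ ab).
Qed.

Lemma edge_invariantU P Q : edge_invariant P -> edge_invariant Q ->
  edge_invariant (fun i g => P i g || Q i g).
Proof.
by move=> invP invQ i a b i' a' b' ab; rewrite (invP _ _ _ _ _ _ ab) (invQ _ _ _ _ _ _ ab).
Qed.

Lemma edge_invariant_exists P : edge_invariant P ->
  edge_invariant (fun i _ => [exists g, P i g]).
Proof.
move=> invP; apply: edge_invariantW => i a b i' a' b' ab /existsP[g Pg].
have [c [d [c' [d' [cd ci]]]]] := edge_rebase g ab.
by apply/existsP; exists (c' i'); rewrite -(invP _ _ _ _ _ _ cd) ci.
Qed.

Section Box.
Variable X : 'I_m -> {set G}.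
Hypothesis X_neq0 : forall i, X i != set0.
Hypothesis box_fibers : union_of_fibers W (box X).

Definition outside a : {set 'I_m} := [set i | a i \notin X i].

Lemma outside_card_le a c : c \in box X -> #|outside a| <= hamming a c.
Proof.
move/boxP=> cX; apply: subset_leq_card; apply/subsetP=> i; rewrite !inE.
by apply: contraNneq => ->.
Qed.

Lemma exists_nearest a : exists2 c, c \in box X & hamming a c = #|outside a|.
Proof.
pose c : pt := [ffun i => if a i \in X i then a i else odflt (a i) [pick g in X i]].
have cX i : c i \in X i.
  rewrite ffunE; case: ifP => // _; case: pickP => //= Xi0.
  by have /set0Pn[g] := X_neq0 i; rewrite Xi0.
exists c; first exact/boxP.
apply: eq_card => i; rewrite !inE; have := cX i; rewrite ffunE.
by case: ifP => [_ _|ai]; [rewrite eqxx | apply: contraTneq => <-; rewrite ai].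
Qed.

Lemma outside_card_class a a' :
  basic W a a = basic W a' a' -> #|outside a| = #|outside a'|.
Proof.
have le_class x y : basic W x x = basic W y y -> #|outside y| <= #|outside x|.
  move=> xy; have [c cX <-] := exists_nearest x.
  have [c' [xc _]] := basic_transport cohW c xy; rewrite (hamming_class xc).
  by apply: outside_card_le; rewrite -(mem_union_of_fibers cohW box_fibers (basic_snd cohW xc)).
by move=> aa; apply/eqP; rewrite eqn_leq !le_class.
Qed.

(* On a line in direction [i] the points with [i]-th coordinate in [X i] are those nearest
   to the box. *)
Lemma edge_invariant_box : edge_invariant (fun i g => g \in X i).
Proof.
apply: edge_invariantW => i a b i' a' b' ab ai; apply: contraT => ai'.
have /set0Pn[g gX] := X_neq0 i'; have ga' : g != a' i' by apply: contraNneq ai' => <-.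
have [c' [c [[ac' ac acW] c'i]]] := edge_retarget (edge_equiv_sym ab) ga'.
have /edgeP[_ ac_j] := ac; have /edgeP[_ ac'_j] := ac'.
have out_ac : outside a \subset outside c.
  apply/subsetP=> j; rewrite !inE; have [->|/ac_j->//] := eqVneq j i; by rewrite ai.
have out_ac' : outside c' \proper outside a'.
  apply/properP; split; last by exists i'; rewrite !inE ?c'i ?gX.
  apply/subsetP=> j; rewrite !inE; have [->|/ac'_j->//] := eqVneq j i'; by rewrite c'i gX.
case: ab => _ _ /(basic_fst cohW)/outside_card_class aa.
have := leq_ltn_trans (subset_leq_card out_ac) _; rewrite aa.
rewrite -(outside_card_class (basic_snd cohW acW)) => /(_ _ (proper_card out_ac')).
by rewrite ltnn.
Qed.

End Box.

Lemma edge_invariant_point x : union_of_fibers W [set x] ->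
  edge_invariant (fun i g => g == x i).
Proof.
rewrite -box_set1 => /edge_invariant_box x_inv.
apply: eq_edge_invariant (x_inv _) => [i g|i]; first by rewrite inE.
by apply/set0Pn; exists (x i); rewrite inE.
Qed.

Definition power (D : {set G}) : {set pt} := box (fun=> D).

Lemma edge_invariant_power D : union_of_fibers W (power D) ->
  edge_invariant (fun _ g => g \in D).
Proof.
have [-> _ i a b i' a' b' _|D_neq0] := eqVneq D set0; first by rewrite !inE.
exact: edge_invariant_box.
Qed.

Lemma union_of_fibers_box (X : 'I_m -> {set G}) : 1 < #|G| ->
  edge_invariant (fun i g => g \in X i) -> union_of_fibers W (box X).
Proof.
move=> G_gt1 invX; apply/(union_of_fibersP cohW) => x y xy /boxP xX; apply/boxP=> i.
have [b yb] := exists_edge y i G_gt1; have [j [c /invX->]] := fiber_edge yb (esym xy).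
exact: xX.
Qed.

Section Completeness.
Hypothesis G_gt1 : 1 < #|G|.
Hypothesis coord_inv : forall i, edge_invariant (fun j _ => j == i).

Lemma edge_equiv_dir i a b i' a' b' : edge_equiv i a b i' a' b' -> i' = i.
Proof. by move/(coord_inv i); rewrite eqxx => /esym/eqP. Qed.

(* The neighbours of [a] in direction [i] nearer to [b] have [i]-th coordinate [b i]. *)
Lemma coord_class_neq a b a' b' i : basic W a b = basic W a' b' -> a i != b i ->
  a' i != b' i /\ basic S (a i) (b i) = basic S (a' i) (b' i).
Proof.
move=> ab ab_i; have ba_i : b i != a i by rewrite eq_sym.
have ac := edge_update ba_i; set c := update a i (b i) in ac.
have ci : c i = b i by rewrite ffunE eqxx.
have [c' [acW cbW]] := basic_transport cohW c ab.
have [i' ac'] := basic_edge ac acW; move: (edge_equiv_dir ac') => i'E; subst i'.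
have [_ ac'_i _] := ac'; have /edgeP[ac_i _] := ac'_i.
have /esym := edge_hamming_lt b' ac'_i; rewrite -(hamming_class cbW) -(hamming_class ab).
rewrite (edge_hamming_lt b ac) ci eqxx => /eqP <-.
by split; rewrite // -ci; apply: edge_equiv_class ac'.
Qed.

Lemma coord_class a b a' b' i : basic W a b = basic W a' b' ->
  (a i == b i) = (a' i == b' i) /\ basic S (a i) (b i) = basic S (a' i) (b' i).
Proof.
move=> ab; have [ab_i|ab_i] := eqVneq (a i) (b i); last first.
  by have [/negPf-> ->] := coord_class_neq ab ab_i.
have [ab'_i|ab'_i] := eqVneq (a' i) (b' i); last first.
  by have [] := coord_class_neq (esym ab) ab'_i; rewrite ab_i eqxx.
split=> //; rewrite -ab_i -ab'_i; have [c ac] := exists_edge a i G_gt1.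
have [i' [c' ac']] := fiber_edge ac (basic_fst cohW ab).
by have := basic_fst cohS (edge_equiv_class ac'); rewrite (edge_equiv_dir ac').
Qed.

Lemma complete_of_edge_invariant (Pi : {set {set G}}) : gen_base S Pi ->
  (forall D, D \in Pi -> edge_invariant (fun _ g => g \in D)) -> cc_complete W.
Proof.
move=> basePi invPi; suff coord_fiber a a' i : basic W a a = basic W a' a' -> a i = a' i.
  apply/(completeP partW) => -[a b] [a' b'] ab; congr (_, _); apply/ffunP=> i.
    exact/coord_fiber/basic_fst/ab.
  exact/coord_fiber/basic_snd/ab.
have ker_inv : class_invariant W (fun a b => [&& a \in setT, b \in setT & a i == b i]).
  by move=> x y x' y' /(@coord_class _ _ _ _ i)[xy_i _]; rewrite !inE.
have coord_onto g : exists2 a : pt, a \in setT & a i = g.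
  by exists [ffun=> g]; rewrite ?inE ?ffunE.
apply: (gen_base_quotient cohW ker_inv coord_onto basePi) => [r x y x' y' _ _ _ _|D x x' _ _|].
- by move=> /(@coord_class _ _ _ _ i)[_ xy] rS; apply: (mem_basic_eq partS rS).
- move=> xx DPi; have [b xb] := exists_edge x i G_gt1.
  have [i' [b' xb']] := fiber_edge xb xx.
  by rewrite (invPi _ DPi _ _ _ _ _ _ xb') (edge_equiv_dir xb').
- by rewrite inE.
Qed.

End Completeness.

(** * Staircases *)

Section Staircase.
Variables (Delta : {set G}) (q : G).

Definition step n i : {set G} := if i < n then Delta else [set q].
Definition staircase : {set pt} := \bigcup_(n < m.+1) box (step n).
Definition staircase_pair : Prop :=
  [/\ q \notin Delta, Delta != set0 & union_of_fibers S [set q] \/ 1 < #|Delta|].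

Hypothesis m_gt1 : 1 < m.
Hypothesis pair_Delta_q : staircase_pair.
Hypothesis staircase_fibers : union_of_fibers W staircase.

Let qDelta : q \notin Delta. Proof. by case: pair_Delta_q. Qed.
Let Delta_neq0 : Delta != set0. Proof. by case: pair_Delta_q. Qed.
Let origin : pt := [ffun=> q].
Let i0 := Ordinal (ltnW m_gt1).
Let i1 := Ordinal m_gt1.

Lemma staircaseP x : reflect (exists2 n, n <= m & x \in box (step n)) (x \in staircase).
Proof.
apply: (iffP bigcupP) => [[n _ xn]|[n nm xn]]; first by exists n; rewrite // -ltnS.
by exists (Ordinal (nm : n < m.+1)).
Qed.

Lemma origin_staircase : origin \in staircase.
Proof. by apply/staircaseP; exists 0 => //; apply/boxP=> i; rewrite ffunE /step inE. Qed.

Lemma hamming_origin_step n x : n <= m -> x \in box (step n) -> hamming origin x = n.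
Proof.
move=> nm /boxP xn; have card_lt : #|[set i : 'I_m | i < n]| = n.
  by rewrite -sum1dep_card (big_ord_narrow nm) sum1_card card_ord.
rewrite -[RHS]card_lt; apply: eq_card => i; rewrite !inE ffunE.
have := xn i; rewrite /step; case: ifP => _; last by rewrite inE eq_sym => ->.
by apply: contraTN => /eqP<-.
Qed.

Lemma box_stepE n x : n <= m ->
  (x \in box (step n)) = (x \in staircase) && (hamming origin x == n).
Proof.
move=> nm; apply/idP/andP=> [xn|[/staircaseP[k km xk]]].
  by rewrite (hamming_origin_step nm xn); split=> //; apply/staircaseP; exists n.
by rewrite (hamming_origin_step km xk) => /eqP<-.
Qed.

Lemma staircase_neighbour n x i : 1 < #|Delta| -> n <= m -> x \in box (step n) -> i <= n ->
  exists2 y, y \in staircase & edge i x y.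
Proof.
move=> Delta_gt1 nm /boxP xn; rewrite leq_eqVlt => /predU1P[ni|i_lt_n].
  have /set0Pn[g gDelta] := Delta_neq0; exists (update x i g); last first.
    apply: edge_update; have := xn i; rewrite /step ni ltnn inE => /eqP->.
    by apply: contraNneq qDelta => <-.
  apply/staircaseP; exists n.+1; first by rewrite -ni.
  apply/boxP=> j; rewrite ffunE /step ltnS leq_eqVlt; have [->|ji] := eqVneq j i.
    by rewrite ni eqxx.
  have /negPf-> : j != n :> nat by rewrite -ni.
  exact: xn.
have [g gDelta gx] := exists_neq_in (x i) Delta_gt1.
exists (update x i g); last exact: edge_update.
apply/staircaseP; exists n => //; apply/boxP=> j; rewrite ffunE.
by have [->|_] := eqVneq j i; rewrite // /step i_lt_n.
Qed.

Lemma staircase_edge_origin w :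
  w \in staircase -> hamming origin w = 1 -> edge i0 origin w.
Proof.
move=> wX ow; have [j ow_j] := hamming1_edge ow.
have : w \in box (step 1) by rewrite box_stepE ?ow ?wX // ltnW.
move/boxP/(_ j); rewrite /step ltnS leqn0; case: eqP => [j0|_].
  by rewrite (_ : i0 = j) //; apply: val_inj.
by have /edgeP[] := ow_j; rewrite ffunE inE eq_sym => /negPf->.
Qed.

(* If [Delta] has two elements, then [origin] is the only point of the staircase whose
   neighbours in it are pairwise adjacent. *)
Lemma origin_fiber : union_of_fibers W [set origin].
Proof.
apply/(union_of_fibersP cohW) => o x ox /set1P oE; rewrite inE {o}oE in ox *.
case: pair_Delta_q => _ _ [q_fiber|Delta_gt1].
  have [l _ lox] := expo_class ox; apply/eqP/ffunP=> i; have := lox (l^-1 i)%g.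
  rewrite permKV !ffunE => /(mem_union_of_fibers cohS q_fiber).
  by rewrite !inE eqxx => /esym/eqP.
have := origin_staircase; rewrite (mem_union_of_fibers cohW staircase_fibers ox).
case/staircaseP=> -[_ x0|n nm xn].
  by apply/eqP/ffunP=> i; move/boxP/(_ i): x0; rewrite ffunE inE => /eqP.
have [y yX xy] := staircase_neighbour (i := i0) Delta_gt1 nm xn isT.
have [z zX xz] := staircase_neighbour (i := i1) Delta_gt1 nm xn isT.
have [y' [xyW _]] := basic_transport cohW y (esym ox).
have [z' [xzW zyW]] := basic_transport cohW z xyW.
have origin_edge w w' : w \in staircase -> hamming x w = 1 ->
    basic W x w = basic W origin w' -> edge i0 origin w'.
  move=> wX xw xwW; apply: staircase_edge_origin; last by rewrite -(hamming_class xwW).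
  by rewrite -(mem_union_of_fibers cohW staircase_fibers (basic_snd cohW xwW)).
have yo' := origin_edge _ _ yX (edge_hamming xy) xyW.
have zo' := origin_edge _ _ zX (edge_hamming xz) xzW.
have := edges_hamming_le1 xz xy; rewrite (hamming_class zyW) (edges_hamming_le1 zo' yo').
by rewrite eqxx -val_eqE.
Qed.

Lemma edge_invariant_step n : n <= m -> edge_invariant (fun i g => g \in step n i).
Proof.
move=> nm; apply: edge_invariant_box => [i|].
  by rewrite /step; case: ifP => // _; apply/set0Pn; exists q; rewrite inE.
apply/(union_of_fibersP cohW) => x y xy; rewrite !box_stepE //.
rewrite (mem_union_of_fibers cohW staircase_fibers xy).
by rewrite (hamming_class (basic_singleton_fiber cohW origin_fiber xy)).
Qed.

Lemma edge_invariant_staircase_set : edge_invariant (fun _ g => g \in Delta).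
Proof.
by apply: eq_edge_invariant (edge_invariant_step (leqnn m)) => i g; rewrite /step ltn_ord.
Qed.

Lemma edge_invariant_staircase_coord i : edge_invariant (fun j _ => j == i).
Proof.
have lt_inv n : n <= m -> edge_invariant (fun j _ => j < n).
  move=> nm; have := edge_invariantI edge_invariant_staircase_set (edge_invariant_step nm).
  move/edge_invariant_exists; apply: eq_edge_invariant => j _.
  apply/existsP/idP=> [[g /andP[gDelta]]|jn].
    by rewrite /step; case: ifP => // _ /set1P gq; rewrite gq (negPf qDelta) in gDelta.
  by have /set0Pn[g gDelta] := Delta_neq0; exists g; rewrite /step jn gDelta.
have := edge_invariantI (lt_inv i.+1 (ltn_ord i)) (edge_invariantN (lt_inv i (ltnW (ltn_ord i)))).
by apply: eq_edge_invariant => j _; rewrite -leqNgt ltnS -eqn_leq val_eqE.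
Qed.

End Staircase.

(** * Bases of the exponentiation *)

Definition mix A p q : pt := [ffun i => if i \in A then p else q].

Lemma edge_invariant_swap_set A p q : basic S p q <> basic S q p ->
  edge_invariant (fun i g => g == mix A p q i) ->
  edge_invariant (fun i g => g == mix A q p i) -> edge_invariant (fun i _ => i \in A).
Proof.
move=> pq inv_pq inv_qp; apply: edge_invariantW => i a b i' a' b' ab iA.
apply: contraT => iA'; case: pq.
have [c [d [c' [d' [cd ci]]]]] := edge_rebase p ab.
have [qp|qp] := eqVneq q p; first by rewrite qp.
rewrite -ci in qp; have [e [e' [ce ei]]] := edge_retarget cd qp.
have := inv_pq _ _ _ _ _ _ ce; rewrite !ffunE iA (negPf iA') ci eqxx => /esym/eqP c'i.
have := inv_qp _ _ _ _ _ _ (edge_equiv_rev ce).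
rewrite !ffunE iA (negPf iA') ei eqxx => /esym/eqP e'i.
by have := edge_equiv_class ce; rewrite ci ei c'i e'i.
Qed.

Lemma edge_invariant_swap_point A p q : edge_invariant (fun i _ => i \in A) ->
  edge_invariant (fun i g => g == mix A p q i) ->
  edge_invariant (fun i g => g == mix A q p i) -> edge_invariant (fun _ g => g == p).
Proof.
move=> invA inv_pq inv_qp; apply: eq_edge_invariant (edge_invariantU
  (edge_invariantI invA inv_pq) (edge_invariantI (edge_invariantN invA) inv_qp)) => i g.
by rewrite !ffunE; case: (i \in A); rewrite /= ?orbF.
Qed.

Lemma edge_invariant_mix_set A p q : p != q -> edge_invariant (fun _ g => g == p) ->
  edge_invariant (fun i g => g == mix A p q i) -> edge_invariant (fun i _ => i \in A).
Proof.
move=> pq inv_p inv_pq.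
apply: eq_edge_invariant (edge_invariant_exists (edge_invariantI inv_p inv_pq)) => i _.
apply/existsP/idP=> [[g]|iA]; last by exists p; rewrite ffunE iA eqxx.
by rewrite ffunE; case: ifP => // _ /andP[/eqP->]; rewrite (negPf pq).
Qed.

Hypothesis antiS : cc_antisymmetric S.

Section Star.
Variables b0 g0 : G.
Hypotheses (g0b0 : g0 != b0) (b0_inv : edge_invariant (fun _ g => g == b0)).

Let centre : pt := [ffun=> b0].

Lemma centre_fiber : union_of_fibers W [set centre].
Proof.
rewrite -box_set1; apply: union_of_fibers_box; first by apply/card_gt1P; exists g0, b0.
by apply: eq_edge_invariant b0_inv => i g; rewrite inE ffunE.
Qed.

Definition star : {set pt} :=
  [set z | [exists i, edge i centre z && (basic S b0 (z i) == basic S b0 g0)]].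

Lemma starP z : reflect (exists2 i, edge i centre z & basic S b0 (z i) = basic S b0 g0)
  (z \in star).
Proof. by rewrite inE; apply: (iffP exists_inP) => -[i cz /eqP]; exists i => //; apply/eqP. Qed.

Lemma basic_loop_neq : basic S b0 b0 <> basic S b0 g0.
Proof. by move/(basic_eq_pt cohS); rewrite eqxx eq_sym (negPf g0b0). Qed.

Lemma star_fibers : union_of_fibers W star.
Proof.
apply/(union_of_fibersP cohW) => z z' zz' /starP[i cz zi].
have [i' cz'] := basic_edge cz (basic_singleton_fiber cohW centre_fiber zz').
apply/starP; exists i'; first by case: cz'.
by have := edge_equiv_class cz'; rewrite !ffunE zi.
Qed.

Variable i0 : 'I_m.
Definition star_dir z := odflt i0 [pick i in diff centre z].

Lemma star_dirE i z : edge i centre z -> star_dir z = i.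
Proof.
move/eqP=> cz; rewrite /star_dir; case: pickP => [j|/(_ i)]; rewrite cz inE ?eqxx //.
by move/eqP.
Qed.

Lemma star_edge z : z \in star -> edge (star_dir z) centre z.
Proof. by case/starP=> i cz _; rewrite (star_dirE cz). Qed.

Lemma star_basic z : z \in star -> basic S b0 (z (star_dir z)) = basic S b0 g0.
Proof. by case/starP=> i /star_dirE->. Qed.

Lemma star_off_dir z i : z \in star -> i != star_dir z -> z i = b0.
Proof. by case/star_edge/edgeP=> _ zi /zi; rewrite ffunE. Qed.

Lemma star_dir_onto i : exists2 z, z \in star & star_dir z = i.
Proof.
have cz : edge i centre (update centre i g0) by apply: edge_update; rewrite ffunE.
exists (update centre i g0); last exact: star_dirE.
by apply/starP; exists i; rewrite // ffunE eqxx.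
Qed.

Lemma star_dir_ker :
  class_invariant W (fun z w => [&& z \in star, w \in star & star_dir z == star_dir w]).
Proof.
move=> z w z' w' zw.
have zz := mem_union_of_fibers cohW star_fibers (basic_fst cohW zw).
have ww := mem_union_of_fibers cohW star_fibers (basic_snd cohW zw).
rewrite -zz -ww; have [zS|//] := boolP (z \in star); have [wS|//] := boolP (w \in star).
have [zS' wS'] : z' \in star /\ w' \in star by rewrite -zz -ww.
rewrite -(edges_hamming_le1 (star_edge zS) (star_edge wS)).
by rewrite -(edges_hamming_le1 (star_edge zS') (star_edge wS')) (hamming_class zw).
Qed.

(* Antisymmetry orders the two coordinates in which two points of the star differ. *)
Lemma star_dir_basic z w i : z \in star -> w \in star -> star_dir z != star_dir w ->
  (basic S (z i) (w i) == basic S g0 b0) = (i == star_dir z).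
Proof.
move=> zS wS zw; have [->|iz] := eqVneq i (star_dir z).
  by rewrite (star_off_dir wS zw); apply/eqP/(basic_inv cohS)/star_basic.
rewrite (star_off_dir zS iz); apply/negbTE/eqP.
have [->|iw] := eqVneq i (star_dir w).
  by rewrite (star_basic wS) => /esym; apply: antisym_basic g0b0.
by rewrite (star_off_dir wS iw) => /(basic_inv cohS); apply: basic_loop_neq.
Qed.

Lemma star_dir_image (l : 'I_m -> 'I_m) z w z' w' :
  z \in star -> w \in star -> z' \in star -> w' \in star ->
  star_dir z != star_dir w -> star_dir z' != star_dir w' ->
  (forall i, basic S (z i) (w i) = basic S (z' (l i)) (w' (l i))) ->
  l (star_dir z) = star_dir z'.
Proof.
move=> zS wS zS' wS' zw zw' zw_l; apply/eqP; rewrite -(star_dir_basic _ zS' wS' zw') -zw_l.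
by rewrite star_dir_basic ?eqxx.
Qed.

Hypothesis transL : [transitive L, on [set: 'I_m] | 'P].

Lemma star_dir_perm z w z' w' : z \in star -> w \in star -> z' \in star -> w' \in star ->
  basic W z w = basic W z' w' -> exists2 l : {perm 'I_m}, l \in L &
    l (star_dir z) = star_dir z' /\ l (star_dir w) = star_dir w'.
Proof.
move=> zS wS zS' wS' zw; have := star_dir_ker zw; rewrite zS wS zS' wS' /=.
have [<- /esym/eqP <-|zw_dir /esym/negbT zw_dir'] := eqVneq (star_dir z) (star_dir w).
  have [l lL zl] := atransP2 transL (in_setT (star_dir z)) (in_setT (star_dir z')).
  by exists l.
have [l lL zw_l] := expo_class zw; exists l => //.
split; first exact: star_dir_image zw_l.
by apply: (@star_dir_image _ w z w' z') => // [||i]; [rewrite eq_sym.. | apply: basic_inv].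
Qed.

Variable Sigma : {set {set 'I_m}}.
Hypotheses (base_Sigma : gen_base (Inv L) Sigma)
  (Sigma_inv : forall A, A \in Sigma -> edge_invariant (fun i _ => i \in A)).

Lemma star_dir_fiber z z' : z \in star -> basic W z z = basic W z' z' ->
  star_dir z = star_dir z'.
Proof.
move: z z'; apply: (gen_base_quotient cohW star_dir_ker star_dir_onto base_Sigma).
  move=> r z w z' w' zS wS zS' wS' /(star_dir_perm zS wS zS' wS')[l lL [<- <-]].
  case/imsetP=> p _ -> /imsetP[k kL [-> ->]].
  by apply/imsetP; exists (k * l)%g; rewrite ?groupM ?permM.
move=> A z z' zS zS' zz' AS.
have [i cz] := basic_edge (star_edge zS) (basic_singleton_fiber cohW centre_fiber zz').
rewrite (Sigma_inv AS cz); case: cz => _ cz _.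
by rewrite (star_dirE cz).
Qed.

Lemma edge_invariant_star_coord : edge_invariant (fun i _ => i == i0).
Proof.
pose X i := if i == i0 then [set g | basic S b0 g == basic S b0 g0] else [set b0].
have X_box z : (z \in box X) = (z \in star) && (star_dir z == i0).
  apply/boxP/andP=> [zX|[zS /eqP zi0] i]; last first.
    rewrite /X; case: eqP => [->|/eqP i_neq]; first by rewrite -zi0 inE star_basic.
    by rewrite (star_off_dir zS) ?zi0 ?inE.
  have zi0 : basic S b0 (z i0) = basic S b0 g0 by have := zX i0; rewrite /X eqxx inE => /eqP.
  have cz : edge i0 centre z.
    apply/edgeP; split=> [|i i_neq]; rewrite ffunE.
      by apply/eqP=> zb; case: basic_loop_neq; rewrite {2}zb.
    by have := zX i; rewrite /X (negPf i_neq) => /set1P->.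
  by rewrite (star_dirE cz); split=> //; apply/starP; exists i0.
have invX : edge_invariant (fun i g => g \in X i).
  apply: edge_invariant_box => [i|].
    by apply/set0Pn; rewrite /X; case: eqP => _; [exists g0 | exists b0]; rewrite inE.
  apply/(union_of_fibersP cohW) => z z' zz'; rewrite !X_box => /andP[zS /eqP <-].
  by rewrite -(mem_union_of_fibers cohW star_fibers zz') zS (star_dir_fiber zS zz') eqxx.
have := edge_invariantN (edge_invariant_exists (edge_invariantI b0_inv invX)).
apply: eq_edge_invariant => i _; rewrite /X; have [_|_] := eqVneq i i0.
  by apply/existsP=> -[g /andP[/eqP->]]; rewrite inE => /eqP; apply: basic_loop_neq.
by apply/negbTE/negPn/existsP; exists b0; rewrite inE !eqxx.
Qed.

End Star.

Section Points.
Variables (B : {set G}) (Sigma : {set {set 'I_m}}) (g1 : G).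

Let n := #|B|.
Let beta k := nth g1 (enum B) k.
Let A k := nth set0 (enum Sigma) k.

Definition partner k := if odd k then k.-1 else if k.+1 < n then k.+1 else k.
Definition paired_pt k : pt := mix (A k./2) (beta k) (beta (partner k)).
Definition extra_pt k : pt := mix (A k) (beta 0) g1.
Definition expo_base : {set pt} :=
  [set paired_pt k | k : 'I_n] :|: [set extra_pt (n./2 + k) | k : 'I_(#|Sigma| - n./2)].

Lemma card_expo_base : #|expo_base| <= n + (#|Sigma| - n./2).
Proof.
apply: leq_trans (leq_card_setU _ _) _.
by apply: leq_add; apply: leq_trans (leq_imset_card _ _) _; rewrite card_ord.
Qed.

Hypotheses (B_gt0 : 0 < n) (g1_neq : beta 0 != g1).
Hypothesis expo_base_fibers : forall x, x \in expo_base -> union_of_fibers W [set x].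

Lemma edge_invariant_paired_pt k : k < n -> edge_invariant (fun i g => g == paired_pt k i).
Proof.
move=> kn; apply/edge_invariant_point/expo_base_fibers.
by rewrite inE; apply/orP; left; apply/imsetP; exists (Ordinal kn).
Qed.

Lemma edge_invariant_pair k : k.*2.+1 < n ->
  [/\ edge_invariant (fun i _ => i \in A k), edge_invariant (fun _ g => g == beta k.*2)
    & edge_invariant (fun _ g => g == beta k.*2.+1)].
Proof.
move=> kn; have inv_even := edge_invariant_paired_pt (ltnW kn).
have inv_odd := edge_invariant_paired_pt kn.
rewrite /paired_pt /partner odd_double kn doubleK in inv_even.
rewrite /paired_pt /partner oddS odd_double /= uphalf_double in inv_odd.
have beta_neq : beta k.*2 != beta k.*2.+1.
  by rewrite nth_uniq ?enum_uniq -?cardE // ?neq_ltn ?ltnS ?leqnn // ltnW.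
have invA := edge_invariant_swap_set (antisym_basic cohS antiS beta_neq) inv_even inv_odd.
split=> //; first exact: edge_invariant_swap_point invA inv_even inv_odd.
exact: edge_invariant_swap_point invA inv_odd inv_even.
Qed.

Lemma edge_invariant_beta k : k < n -> edge_invariant (fun _ g => g == beta k).
Proof.
move=> kn; have := odd_double_half k; have [k_odd kE|k_even kE] := boolP (odd k).
  by have [|_ _] := @edge_invariant_pair k./2; rewrite -[_.*2.+1]add1n kE.
rewrite add0n in kE; have [kn'|nk] := ltnP k.+1 n.
  by have [|_ + _] := @edge_invariant_pair k./2; rewrite kE.
apply: eq_edge_invariant (edge_invariant_paired_pt kn) => i g.
by rewrite ffunE /partner (negPf k_even) ltnNge nk if_same.
Qed.

Lemma edge_invariant_mem_Sigma X : X \in Sigma -> edge_invariant (fun i _ => i \in X).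
Proof.
rewrite -mem_enum => XSigma; rewrite -(nth_index set0 XSigma) -/(A _).
move: XSigma; rewrite -index_mem -cardE; move: (index X _) => k k_lt.
have [kn|nk] := ltnP k n./2.
  by have [] // := @edge_invariant_pair k; rewrite geq_half_double doubleS in kn.
have k_lt' : k - n./2 < #|Sigma| - n./2 by rewrite ltn_sub2r // (leq_ltn_trans nk).
apply: (edge_invariant_mix_set g1_neq (edge_invariant_beta B_gt0)).
apply/(edge_invariant_point (x := extra_pt k))/expo_base_fibers; rewrite inE; apply/orP; right.
by apply/imsetP; exists (Ordinal k_lt'); rewrite //= subnKC.
Qed.

Hypotheses (transL : [transitive L, on [set: 'I_m] | 'P]).
Hypotheses (base_B : base S B) (base_Sigma : gen_base (Inv L) Sigma).

Lemma complete_of_expo_base : cc_complete W.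
Proof.
apply: (complete_of_edge_invariant _ _ base_B) => [|i|_ /imsetP[g gB ->]].
- by apply/card_gt1P; exists (beta 0), g1.
- apply: (edge_invariant_star_coord (g0 := g1) _ (edge_invariant_beta B_gt0) _ transL base_Sigma).
    by rewrite eq_sym.
  exact: edge_invariant_mem_Sigma.
have g_index : index g (enum B) < n by rewrite /n cardE index_mem mem_enum.
apply: eq_edge_invariant (edge_invariant_beta g_index) => i h.
by rewrite /beta nth_index ?mem_enum // inE.
Qed.

End Points.

End ExpoFission.

(** * Bounds for the exponentiation *)

Section ExpoBounds.
Variables (G : finType) (m : nat) (S : {set {set G * G}}) (L : {group {perm 'I_m}}).
Hypotheses (cohS : coherent S) (antiS : cc_antisymmetric S).

Lemma exists_staircase_pair (D : {set G}) : 1 < #|G| -> exists (Delta : {set G}) (q : G),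
  staircase_pair S Delta q /\ D \in [:: set0; setT; Delta; ~: Delta].
Proof.
move=> G_gt1; have pairI (Delta : {set G}) (q : G) : q \notin Delta -> Delta != set0 ->
    (2 < #|G| -> 1 < #|Delta|) -> staircase_pair S Delta q.
  move=> qDelta Delta_neq0 Delta_gt1; split=> //.
  by have [/(antisym_singleton_fiber cohS antiS)|/Delta_gt1] := leqP #|G| 2; [left | right].
have [D_trivial|] := boolP ((D == set0) || (D == setT)).
  have /card_gt0P[q _] := ltnW G_gt1; exists [set~ q], q; split; last first.
    by rewrite !inE orbA D_trivial.
  have card_q : #|[set~ q]| = #|G|.-1 by rewrite cardsC1.
  by apply: pairI; rewrite -?card_gt0 ?card_q ?inE ?eqxx //; case: #|G| G_gt1 => [|[|[]]].
rewrite negb_or => /andP[D_neq0]; rewrite -subTset => /subsetPn[q _ qD].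
have /set0Pn[p pD] := D_neq0; have [D_le1|D_gt1] := leqP #|D| 1; last first.
  by exists D, q; rewrite !inE eqxx !orbT; split=> //; apply: pairI.
exists (~: D), p; rewrite setCK !inE eqxx !orbT; split=> //; apply: pairI.
- by rewrite inE pD.
- by apply/set0Pn; exists q; rewrite inE.
- by rewrite -(cardsC D); apply: contraLR; rewrite -!leqNgt => /(leq_add D_le1).
Qed.

Lemma gen_base_powers (Pi : {set {set G}}) : 1 < #|G| -> m <= 1 -> gen_base S Pi ->
  gen_base (expo S L) [set power m D | D in Pi].
Proof.
move=> G_gt1 m_le1 base_Pi; apply/gen_baseP => W fisW fibersW.
apply: (complete_of_edge_invariant cohS fisW G_gt1 _ base_Pi) => [i j a b j' a' b' _|D DPi].
  have /fintype_le1P eqI : #|'I_m| <= 1 by rewrite card_ord.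
  by rewrite (eqI j j').
by apply: (edge_invariant_power cohS fisW); apply/fibersW/imset_f.
Qed.

Lemma gen_base_staircase (Pi : {set {set G}}) D Delta q : 1 < #|G| -> 1 < m ->
  gen_base S Pi -> staircase_pair S Delta q -> D \in [:: set0; setT; Delta; ~: Delta] ->
  gen_base (expo S L) (staircase m Delta q |: [set power m X | X in Pi :\ D]).
Proof.
move=> G_gt1 m_gt1 base_Pi pairDq D_Delta; apply/gen_baseP => W fisW fibersW.
have stair_fibers : union_of_fibers W (staircase m Delta q) by apply: fibersW; rewrite setU11.
have invDelta := edge_invariant_staircase_set cohS fisW m_gt1 pairDq stair_fibers.
apply: (complete_of_edge_invariant cohS fisW G_gt1 _ base_Pi) => [|X XPi].
  exact: (edge_invariant_staircase_coord cohS fisW m_gt1 pairDq stair_fibers).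
have [{X XPi}->|XD] := eqVneq X D; last first.
  apply: (edge_invariant_power cohS fisW); apply: fibersW.
  by rewrite inE orbC imset_f // !inE XD.
move: D_Delta; rewrite !inE => /or4P[] /eqP->.
- by move=> i a b i' a' b' _; rewrite !inE.
- by move=> i a b i' a' b' _; rewrite !inE.
- exact: invDelta.
- by apply: eq_edge_invariant (edge_invariantN invDelta) => _ g; rewrite inE.
Qed.

Lemma expo_gen_base_bound (Pi : {set {set G}}) n : gen_base S Pi -> (1 < m -> 0 < n) ->
  exists Pi', gen_base (expo S L) Pi' /\ #|Pi'| <= maxn #|Pi| n.
Proof.
move=> base_Pi n_gt0; have [G_le1|G_gt1] := leqP #|G| 1.
  exists set0; rewrite cards0; split=> //; apply/gen_baseP => W [cohW _] _.
  apply/(complete_card_le1 (coherent_partition cohW))/fintype_le1P => a b.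
  by apply/ffunP=> i; apply: (fintype_le1P G_le1).
have [m_le1|m_gt1] := leqP m 1.
  exists [set power m D | D in Pi]; split; first exact: gen_base_powers.
  exact: leq_trans (leq_imset_card _ _) (leq_maxl _ _).
pose D := odflt set0 [pick D in Pi].
have [Delta [q [pairDq D_Delta]]] := exists_staircase_pair D G_gt1.
exists (staircase m Delta q |: [set power m X | X in Pi :\ D]).
split; first exact: gen_base_staircase.
have card_PiD : #|Pi :\ D| < maxn #|Pi| n.
  rewrite /D; case: pickP => [X XPi|Pi0] /=.
    by rewrite leq_max (cardsD1 X Pi) XPi add1n leqnn.
  by rewrite (eq_card0 (A := _ :\ _)) ?leq_max ?n_gt0 ?orbT // => X; rewrite inE Pi0 andbF.
rewrite cardsU1; apply: leq_trans card_PiD; rewrite -add1n leq_add ?leq_imset_card //.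
exact: leq_b1.
Qed.

Lemma base_gt0 (B : {set G}) : ~ cc_complete S -> base S B -> 0 < #|B|.
Proof.
move=> nS baseB; rewrite card_gt0; apply/eqP=> B0; apply: nS.
by apply: gen_base_set0 => //; move: baseB; rewrite /base B0 imset0.
Qed.

Lemma expo_base_bound (B : {set G}) (Sigma : {set {set 'I_m}}) :
  [transitive L, on [set: 'I_m] | 'P] -> ~ cc_complete S ->
  base S B -> gen_base (Inv L) Sigma ->
  exists B' : {set {ffun 'I_m -> G}},
    base (expo S L) B' /\ #|B'| <= #|B| + (#|Sigma| - #|B|./2).
Proof.
move=> transL nS baseB baseSigma; have B_gt0 := base_gt0 nS baseB.
have /card_gt0P[g gB] := B_gt0.
have G_gt1 : 1 < #|G|.
  rewrite ltnNge; apply/negP=> /(complete_card_le1 (coherent_partition cohS)).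
  exact: nS.
have [g1 _ g1_neq] := exists_neq_in (A := G) (nth g (enum B) 0) G_gt1.
exists (expo_base B Sigma g1); split; last exact: card_expo_base.
apply/gen_baseP => W fisW fibersW.
apply: (complete_of_expo_base cohS fisW antiS B_gt0 _ _ transL baseB baseSigma (g1 := g1)).
  by rewrite (set_nth_default g) -?cardE // eq_sym.
by move=> x xB; apply/fibersW/imset_f.
Qed.

End ExpoBounds.

Theorem theorem7p1 (G : finType) (S : {set {set G * G}}) (m : nat)
    (L : {group {perm 'I_m}}) :
  coherent S -> cc_antisymmetric S ->
  [transitive L, on [set: 'I_m] | 'P] -> odd #|L| ->
  (forall gY b, is_gb S gY -> is_gb (Inv L) b ->
     exists Pi, gen_base (expo S L) Pi /\ #|Pi| <= maxn gY b) /\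
  (~ cc_complete S -> forall bY b, is_b S bY -> is_gb (Inv L) b ->
     exists B, base (expo S L) B /\ #|B| <= bY + (b - (bY.-1.+1 %/ 2))).
Proof.
move=> cohS antiS transL _; split=> [_ _ [[Pi [basePi <-]] _] [[Sigma [baseSigma <-]] _]|nS].
  by apply: expo_gen_base_bound => // m_gt1; apply: gen_base_Inv_gt0 baseSigma.
move=> _ _ [[B [baseB <-]] _] [[Sigma [baseSigma <-]] _].
rewrite prednK ?(base_gt0 cohS nS baseB) // divn2.
exact: expo_base_bound.
Qed.
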